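(* Let $G$ be a compact group with identity component $G^\circ$, and let $L$ and $K$ be irreducible finite-dimensional continuous real $G$-representations, with actions $\rho_L$ and $\rho_K$. Then the following hold. (1) Suppose that $G^\circ$ acts trivially on $L$. Then \[ \operatorname{Hom}^{\mathrm{pl}}_G(L,K)\neq 0 \quad\Longleftrightarrow\quad \ker(\rho_L)\subseteq\ker(\rho_K). \] (2) Suppose that $G^\circ$ acts non-trivially on $L$. Then every $G$-equivariant piecewise linear map $L\to K$ is affine linear, and \[ \operatorname{Hom}^{\mathrm{pl}}_G(L,K)\neq 0 \quad\Longleftrightarrow\quad L\cong K \ \text{ or }\ K\cong \mathbb{R}_{\mathrm{triv}}. \]
   Context: A representation of $G$ on a finite-dimensional real vector space $L$ is a continuous group homomorphism $\rho_L\colon G\to \operatorname{GL}(L)$. It is irreducible if $L\ne\{0\}$ and its only $G$-invariant linear subspaces are $\{0\}$ and $L$. $L\cong K$ means that there is a $G$-equivariant linear isomorphism $L\to K$. $\mathbb{R}_{\mathrm{triv}}$ is the one-dimensional real representation on which every $g\in G$ acts as the identity. A map $\Phi\colon L\to K$ is $G$-equivariant if $\rho_K(g)\Phi(l)=\Phi(\rho_L(g)l)$ for all $g\in G$, $l\in L$. A map $f\colon V\to W$ of finite-dimensional real vector spaces is affine linear if $f(x)=M(x)+b$ for some linear $M\colon V\to W$ and $b\in W$. A convex polyhedral subset of $V$ is an intersection of finitely many closed affine half-spaces (possibly none). A map $f\colon V\to W$ is piecewise linear if there are finitely many convex polyhedral subsets $A_1,\dots,A_m$ with $V=\bigcup_i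 A_i$ such that for every $i$ there are a linear map $M_i\colon V\to W$ and $b_i\in W$ with $f(x)=M_i(x)+b_i$ for all $x\in A_i$. $\operatorname{Hom}^{\mathrm{pl}}_G(L,K)$ is the vector space of $G$-equivariant piecewise linear maps $L\to K$. *)

(* Defs.v *)
From HB Require Import structures.
From mathcomp Require Import all_boot all_order all_algebra.
From mathcomp Require Import all_classical all_reals all_analysis.
Set Implicit Arguments.
Unset Strict Implicit.
Unset Printing Implicit Defensive.
Import Order.TTheory GRing.Theory Num.Theory numFieldNormedType.Exports.
Local Open Scope classical_set_scope.
Local Open Scope ring_scope.

HB.mixin Record Topological_isTopologicalGroup G of Group G & Topological G := {
  mulg_continuous : continuous (fun x : G * G => (x.1 * x.2)%g);
  invg_continuous : continuous (fun x : G => (x^-1)%g)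
}.

#[short(type="topologicalGroupType")]
HB.structure Definition TopologicalGroup :=
  {G of Topological_isTopologicalGroup G & Group G & Topological G}.

Definition compact_group (G : topologicalGroupType) : Prop :=
  hausdorff_space G /\ compact [set: G].

Definition identity_component (G : topologicalGroupType) : set G :=
  connected_component [set: G] 1%g.
Arguments identity_component G : clear implicits.

(* The topology of GL(L) is that of the matrix entries in a basis of L; it does
   not depend on the basis. A homomorphism into 'End(L) has values in GL(L). *)
Record representation (R : realType) (G : topologicalGroupType)
    (L : vectType R) := Representation {
  repr_fun :> G -> 'End(L);
  repr_1 : repr_fun 1%g = \1%VF;
  repr_M : forall g h : G, repr_fun (g * h)%g = (repr_fun g \o repr_fun h)%VF;
  repr_continuous :
    continuous (fun g : G => passmx.mxof (vbasis {:L}) (vbasis {:L}) (repr_fun g))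
}.

Section Representations.
Variables (R : realType) (G : topologicalGroupType).

Definition repr_ker (L : vectType R) (rho : representation G L) : set G :=
  [set g | rho g = \1%VF].

Definition acts_trivially (L : vectType R) (rho : representation G L)
    (H : set G) : Prop :=
  forall g, H g -> forall l : L, rho g l = l.

Definition irreducible (L : vectType R) (rho : representation G L) : Prop :=
  {:L}%VS <> 0%VS /\
  forall U : {vspace L}, (forall g, (rho g @: U <= U)%VS) ->
    U = 0%VS \/ U = {:L}%VS.

Definition equivariant (L K : vectType R) (rhoL : representation G L)
    (rhoK : representation G K) (f : L -> K) : Prop :=
  forall (g : G) (l : L), rhoK g (f l) = f (rhoL g l).

Definition isomorphic (L K : vectType R) (rhoL : representation G L)
    (rhoK : representation G K) : Prop :=
  exists f : 'Hom(L, K), bijective f /\ equivariant rhoL rhoK f.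

Definition triv_fun (g : G) : 'End(R^o) := \1%VF.

Fact triv_fun_1 : triv_fun 1%g = \1%VF.
Proof. by []. Qed.

Fact triv_fun_M (g h : G) : triv_fun (g * h)%g = (triv_fun g \o triv_fun h)%VF.
Proof. by rewrite /triv_fun comp_lfun1l. Qed.

Fact triv_fun_continuous :
  continuous (fun g => passmx.mxof (vbasis {:R^o}) (vbasis {:R^o}) (triv_fun g)).
Proof. by move=> g; apply: cvg_cst. Qed.

Definition triv_repr : representation G R^o :=
  Representation triv_fun_1 triv_fun_M triv_fun_continuous.

End Representations.

Arguments triv_repr R G : clear implicits.

Section PiecewiseLinear.
Variable R : realType.

Definition affine_linear (V W : vectType R) (f : V -> W) : Prop :=
  exists (M : 'Hom(V, W)) (b : W), forall x, f x = M x + b.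

Definition closed_half_space (V : vectType R) (H : set V) : Prop :=
  exists (phi : 'Hom(V, R^o)) (c : R),
    phi <> 0 /\ H = [set x | (phi x : R) <= c].

Definition convex_polyhedral (V : vectType R) (A : set V) : Prop :=
  exists (n : nat) (H : 'I_n -> set V),
    (forall i, closed_half_space (H i)) /\ A = \bigcap_i H i.

Definition piecewise_linear (V W : vectType R) (f : V -> W) : Prop :=
  exists (m : nat) (A : 'I_m -> set V),
    [/\ forall i, convex_polyhedral (A i),
        [set: V] = \bigcup_i A i &
        forall i, exists (M : 'Hom(V, W)) (b : W),
          forall x, A i x -> f x = M x + b].

End PiecewiseLinear.

Definition Hom_pl (R : realType) (G : topologicalGroupType) (L K : vectType R)
    (rhoL : representation G L) (rhoK : representation G K) : set (L -> K) :=
  [set f | equivariant rhoL rhoK f /\ piecewise_linear f].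

Section HomPlSubmodule.
Variables (R : realType) (G : topologicalGroupType) (L K : vectType R).
Variables (rhoL : representation G L) (rhoK : representation G K).

Lemma convex_polyhedralI (A B : set L) :
  convex_polyhedral A -> convex_polyhedral B -> convex_polyhedral (A `&` B).
Proof.
move=> [n [H [Hh ->]]] [m [H' [Hh' ->]]].
exists (n + m)%N, (fun i => match fintype.split i with inl j => H j | inr j => H' j end).
split=> [i|]; first by case: (fintype.split i).
apply/seteqP; split=> [x [xH xH'] i _|x xH].
  by case: (fintype.split i) => j; [exact: xH|exact: xH'].
split=> i _; first by have := xH (unsplit (inl i)) I; rewrite unsplitK.
by have := xH (unsplit (inr i)) I; rewrite unsplitK.
Qed.

Fact Hom_pl0 : Hom_pl rhoL rhoK 0.
Proof.
split=> [g l|]; first exact: linear0.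
exists 1%N, (fun=> [set: L]); split=> [_||_]; last first.
- by exists 0, 0 => x _; rewrite lfunE addr0.
- by apply/seteqP; split=> // x _; exists ord0.
exists 0%N, (fun=> setT); split=> [[]//|].
by apply/seteqP; split=> // x _ [].
Qed.

Fact Hom_pl_linear (a : R) (f g : L -> K) :
  Hom_pl rhoL rhoK f -> Hom_pl rhoL rhoK g -> Hom_pl rhoL rhoK (a *: f + g).
Proof.
move=> [fG [m [A [Ap Ac Af]]]] [gG [n [B [Bp Bc Bg]]]].
have E x : (a *: f + g) x = a *: f x + g x by [].
split=> [h l|]; first by rewrite !E linearP /= fG gG.
pose p (k : 'I_#|{: 'I_m * 'I_n}|) := enum_val k.
exists _, (fun k => A (p k).1 `&` B (p k).2); split=> [k||k].
- exact: convex_polyhedralI.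
- apply/seteqP; split=> // x _.
  have [i _ Ax] : (\bigcup_i A i) x by rewrite -Ac.
  have [j _ Bx] : (\bigcup_j B j) x by rewrite -Bc.
  by exists (enum_rank (i, j)) => //; rewrite /p enum_rankK.
have [M [b fE]] := Af (p k).1; have [N [c gE]] := Bg (p k).2.
exists (a *: M + N), (a *: b + c) => x [Ax Bx].
by rewrite E (fE x Ax) (gE x Bx) !lfunE /= lfunE /= scalerDr addrACA.
Qed.

End HomPlSubmodule.

(* Main.v *)
(** If G° acts trivially on L, the component of 1 is the intersection of the
clopen sets containing 1, so some clopen set around 1 acts on L by operators
close to the identity; the elements mapping it into itself form a neighbourhood
of 1 whose powers all stay close to the identity, hence they act trivially.
So G acts on L through a finite group, and a hinge function at an exposed point
of a free orbit, summed over this group against a vector of K, is a nonzero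
equivariant piecewise linear map as soon as ker rhoL acts trivially on K.

If G° acts nontrivially, an equivariant piecewise linear f selects among
finitely many affine maps, and G permutes those which agree with f on a set not
covered by finitely many hyperplanes. By connectedness G° fixes each of them.
The difference of two of them cannot have rank one, because L has no nonzero
G°-invariant functional; so two of them coincide only in codimension at least
two, a generic line meets no such locus, and f follows a single affine map along
it. Schur's lemma does the rest. *)

Require Import Defs.
From HB Require Import structures.
From mathcomp Require Import all_boot all_order all_algebra.
From mathcomp Require Import all_classical all_reals all_analysis.
From mathcomp Require Import ring lra.
Import Order.TTheory GRing.Theory Num.Theory numFieldNormedType.Exports.
Local Open Scope classical_set_scope.
Local Open Scope ring_scope.
Set Implicit Arguments.
Unset Strict Implicit.
Unset Printing Implicit Defensive.

(** * Thin sets *)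

Lemma functional_separates (F : fieldType) (V : vectType F) (U : {vspace V})
    (w : V) : w \notin U ->
  exists psi : 'Hom(V, F^o), (forall u, u \in U -> psi u = 0) /\ psi w = 1.
Proof.
move=> wU; pose v := w - projv U w.
have v0 : v != 0.
  by apply: contra wU; rewrite subr_eq0 => /eqP ->; exact: memv_proj.
have [i ci] : exists i, coord (vbasis {:V}) i v != 0.
  apply/existsP; apply: contraNT v0; rewrite negb_exists => /forallP c0.
  rewrite (coord_vbasis (memvf v)) big1 // => i _.
  by move: (c0 i); rewrite negbK => /eqP ->; rewrite scale0r.
pose c : 'Hom(V, F^o) := linfun (coord (vbasis {:V}) i : V -> F^o).
have cv : c v = coord (vbasis {:V}) i v by rewrite lfunE.
exists ((coord (vbasis {:V}) i v)^-1 *: (c \o (\1 - projv U)))%VF; split.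
- move=> u uU; rewrite scale_lfunE comp_lfunE add_lfunE opp_lfunE id_lfunE.
  by rewrite projv_id // subrr linear0 scaler0.
- rewrite scale_lfunE comp_lfunE add_lfunE opp_lfunE id_lfunE -/v cv.
  by rewrite /GRing.scale /= mulVf.
Qed.

Lemma functional_neq0 (F : fieldType) (V : vectType F) (w : V) : w != 0 ->
  exists psi : 'Hom(V, F^o), psi w = 1.
Proof.
by rewrite -memv0 => /functional_separates [psi [_ psiw]]; exists psi.
Qed.

(** A subspace of maximal dimension inside [P] works: enlarging it by a vector of [P] stays inside
    [P], so by maximality that vector was already in it. This turns common kernels and spaces of
    fixed vectors into [{vspace V}]. *)
Lemma vspace_of_linear_closed (F : fieldType) (V : vectType F) (P : V -> Prop) :
  P 0 -> (forall a x y, P x -> P y -> P (a *: x + y)) ->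
  exists U : {vspace V}, forall x, x \in U <-> P x.
Proof.
move=> P0 PL; pose Q (n : nat) := exists2 U : {vspace V},
  (forall x, x \in U -> P x) & \dim U = n.
have Q0 : exists n, `[<Q n>].
  exists 0%N; apply/asboolP; exists 0%VS; last exact: dimv0.
  by move=> x; rewrite memv0 => /eqP ->.
have Qb n : `[<Q n>] -> (n <= \dim {:V})%N.
  by move=> /asboolP[U _ <-]; apply: dimvS; exact: subvf.
case: (ex_maxnP Q0 Qb) => n /asboolP[U UP dU] nmax.
exists U => x; split=> [|Px]; first exact: UP.
have UxP y : y \in (<[x]> + U)%VS -> P y.
  move=> /memv_addP[_ /vlineP[a ->] [v vU ->]]; apply: PL => //; exact: UP.
have le : (\dim (<[x]> + U) <= \dim U)%N.
  by rewrite dU; apply: nmax; apply/asboolP; exists (<[x]> + U)%VS.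
have : (<[x]> + U <= U)%VS.
  by rewrite -(dimv_leqif_sup (addvSr _ _)) eqn_leq le dimvS // addvSr.
by move=> /subvP; apply; apply: (subvP (addvSl _ _)); exact: memv_line.
Qed.

Section Thin.
Context {R : realType} {V : vectType R}.

(** Smallness without a topology or a measure on [V]: a pair [(phi, c)] codes the affine hyperplane
    [phi x = c], and finitely many of these must cover the set. *)
Definition thin (A : set V) : Prop :=
  exists2 s : seq ('Hom(V, R^o) * R), all (fun p : 'Hom(V, R^o) * R => p.1 != 0) s &
    forall x, A x -> has (fun p : 'Hom(V, R^o) * R => p.1 x == p.2) s.

Lemma sub_thin (A B : set V) : A `<=` B -> thin B -> thin A.
Proof. by move=> AB [s s0 sB]; exists s => // x /AB/sB. Qed.

Lemma thin0 : thin set0.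
Proof. by exists [::]. Qed.

Lemma thinU (A B : set V) : thin A -> thin B -> thin (A `|` B).
Proof.
move=> [s s0 sA] [r r0 rB]; exists (s ++ r); first by rewrite all_cat s0.
by move=> x [/sA|/rB]; rewrite has_cat => ->; rewrite ?orbT.
Qed.

Lemma thin_bigcup (I : eqType) (s : seq I) (A : I -> set V) :
  (forall i, i \in s -> thin (A i)) -> thin (\bigcup_(i in [set` s]) A i).
Proof.
elim: s => [_|i s IH si]; first by apply: sub_thin thin0 => x [].
apply: (@sub_thin _ (A i `|` \bigcup_(j in [set` s]) A j)); last first.
  apply: thinU; first by apply: si; rewrite mem_head.
  by apply: IH => j js; apply: si; rewrite in_cons js orbT.
move=> x [j /=]; rewrite in_cons => /orP[/eqP -> Ax|js Ax]; first by left.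
by right; exists j.
Qed.

Lemma thin_hyperplane (phi : 'Hom(V, R^o)) (c : R) :
  phi != 0 -> thin [set x | (phi x : R) = c].
Proof.
move=> phi0; exists [:: (phi, c)]; first by rewrite /= phi0.
by move=> x /= ->; rewrite eqxx.
Qed.

Lemma thin_comp_lfun (h k : 'End(V)) (A : set V) :
  (h \o k)%VF = \1%VF -> thin A -> thin (h @^-1` A).
Proof.
move=> hk [s s0 sA]; exists [seq ((p.1 \o h)%VF, p.2) | p <- s].
  rewrite all_map; apply: sub_all s0 => p /=; apply: contra => /eqP ph0.
  by rewrite -[p.1]comp_lfun1r -hk comp_lfunA ph0 comp_lfun0l.
move=> x /sA; rewrite has_map => /hasP[p ps /= px].
by apply/hasP; exists p => //=; rewrite comp_lfunE.
Qed.

Lemma exists_notin (s : seq R) : exists t, t \notin s.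
Proof.
have [M sM] : exists M, forall u, u \in s -> u <= M.
  elim: s => [|u s [M sM]]; first by exists 0.
  exists (Num.max u M) => w; rewrite in_cons le_max => /orP[/eqP ->|/sM ->].
    by rewrite lexx.
  by rewrite orbT.
exists (M + 1); apply/negP => /sM; by rewrite gerDl ler10.
Qed.

Lemma common_nonroot (s : seq 'Hom(V, R^o)) : all (fun phi => phi != 0) s ->
  exists v, all (fun phi : 'Hom(V, R^o) => phi v != 0) s.
Proof.
elim: s => [_|phi s IH /= /andP[phi0 /IH[v vs]]]; first by exists 0.
have /lfunPn[w] := phi0; rewrite zero_lfunE => phiw.
(* The forbidden values of [t] are the roots of [psi (v + t *: w)]. If [psi w = 0], the quotient is
   the default value 0, and excluding it does no harm. *)
have [t tbad] := exists_notin
  (- (phi v : R) / phi w :: [seq - (psi v : R) / psi w | psi : 'Hom(V, R^o) <- s]).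
exists (v + t *: w); apply/andP; split.
  apply: contraNneq tbad; rewrite linearD linearZ /= => /eqP.
  rewrite addrC addr_eq0 => /eqP tw; rewrite in_cons; apply/orP; left.
  by apply/eqP; rewrite -tw [_ *: _]mulrC mulrAC divff // mul1r.
apply/allP => psi psis; have /= psiv := allP vs _ psis.
have [psiw0|psiw0] := eqVneq (psi w) 0.
  by rewrite linearD linearZ /= psiw0 scaler0 addr0.
apply: contraNneq tbad; rewrite linearD linearZ /= => /eqP.
rewrite addrC addr_eq0 => /eqP tw; rewrite in_cons; apply/orP; right.
apply/mapP; exists psi => //.
by rewrite -tw [_ *: _]mulrC mulrAC divff // mul1r.
Qed.

(** A direction parallel to none of the hyperplanes meets each of them exactly once, whatever the
    base point. *)
Lemma thin_line (A : set V) : thin A -> exists v : V, forall x : V,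
  exists s : seq R, forall t : R, A (x + t *: v) -> t \in s.
Proof.
move=> [s s0 sA]; have [|v vs] := @common_nonroot [seq p.1 | p <- s].
  by rewrite all_map.
exists v => x; exists [seq (p.2 - (p.1 x : R)) / (p.1 v : R) |
  p : 'Hom(V, R^o) * R <- s].
move=> t /sA/hasP[p ps /eqP]; rewrite linearD linearZ /= => e.
have pv0 : p.1 v != 0 by apply: (allP vs); exact: map_f.
apply/mapP; exists p => //; rewrite -e.
by rewrite addrC addKr [_ *: _]mulrC mulrAC divff // mul1r.
Qed.

Lemma not_thinT : ~ thin [set: V].
Proof.
move=> /thin_line[v /(_ 0)[s sT]].
by have [t /negP[]] := exists_notin s; exact: sT.
Qed.

End Thin.

(** * Piecewise linear maps on lines *)

Section PiecewiseLinearOnLines.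
Context {R : realType}.

(** No real number is isolated, so the complement of a finite set is dense. *)
Lemma closed_cofinite (C : set R) (s : seq R) :
  closed C -> (forall t, t \notin s -> C t) -> forall t, C t.
Proof.
move=> cC sC t.
have near_s : \forall u \near t^', u \notin s.
  elim: s {sC} => [|r s IH]; first exact: nearW.
  near=> u; rewrite in_cons negb_or; apply/andP; split; last by near: u.
  near: u; have [->|rt] := eqVneq r t; first exact: nbhs_dnbhs_neq.
  apply: nbhs_dnbhs; have : nbhs t (~` [set r]).
    apply: open_nbhs_nbhs; split; last by move=> /= tr; rewrite tr eqxx in rt.
    by rewrite openC; exact: closed_eq.
  by apply: filterS => u ur; apply/eqP => ur'; apply: ur.
apply: cC => B Bt.
have : \forall u \near t^', C u /\ B u.
  near=> u; split; first by apply: sC; near: u.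
  by near: u; apply: nbhs_dnbhs.
by move=> /(@filter_ex _ _ (Proper_dnbhs_numFieldType t))[u [Cu Bu]]; exists u.
Unshelve. all: by end_near. Qed.

Lemma affine_path_continuous (u w : R) : continuous (fun t : R => u + t * w).
Proof.
move=> t; apply: cvgD; first exact: cvg_cst.
by apply: cvgM; [exact: cvg_id|exact: cvg_cst].
Qed.

(** As [W] carries no topology, vanishing is tested by all functionals, each of which gives a closed
    condition on [t]. *)
Lemma closed_line_lfun0 (W : vectType R) (u w : W) :
  closed [set t : R | u + t *: w = 0].
Proof.
have -> : [set t : R | u + t *: w = 0] = \bigcap_(psi in [set: 'Hom(W, R^o)])
    (fun t : R => (psi u : R) + t * psi w) @^-1` [set 0].
  apply/seteqP; split => t /=.
    move=> e psi _ /=; have := congr1 psi e.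
    by rewrite linearD linearZ linear0.
  move=> psi0; apply: contrapT => /eqP/functional_neq0[psi].
  rewrite linearD linearZ /=; have -> := psi0 psi I.
  by apply/eqP; rewrite eq_sym oner_eq0.
apply: closed_bigI => psi _; apply: closed_comp.
  by move=> t _; exact: affine_path_continuous.
exact: closed_eq.
Qed.

Variables V W : vectType R.

Lemma closed_line_polyhedral (A : set V) (x v : V) :
  convex_polyhedral A -> closed [set t : R | A (x + t *: v)].
Proof.
move=> [n [H [Hh ->]]].
have -> : [set t : R | (\bigcap_i H i) (x + t *: v)] =
    \bigcap_i [set t : R | H i (x + t *: v)].
  by apply/seteqP; split=> t.
apply: closed_bigI => i _; have [phi [c [_ ->]]] := Hh i.
have -> : [set t : R | [set y | (phi y : R) <= c] (x + t *: v)] =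
    (fun t : R => (phi x : R) + t * phi v) @^-1` [set r | r <= c].
  by apply/seteqP; split=> t /=; rewrite linearD linearZ.
apply: closed_comp; last exact: closed_le.
by move=> t _; exact: affine_path_continuous.
Qed.

Definition affine (a : 'Hom(V, W) * W) (x : V) : W := a.1 x + a.2.

Lemma affine_line (a : 'Hom(V, W) * W) (x v : V) (t : R) :
  affine a (x + t *: v) = affine a x + t *: a.1 v.
Proof. by rewrite /affine linearD linearZ /= addrAC. Qed.

(** Equal linear parts leave no coincidence at all; otherwise a functional that detects their
    difference confines the coincidences to one hyperplane. *)
Lemma thin_affine_eq (a b : 'Hom(V, W) * W) :
  a != b -> thin [set x | affine a x = affine b x].
Proof.
case: a b => [M u] [N w] ab.
have [MN|MN] := eqVneq M N.
  apply: sub_thin thin0 => x /=; rewrite /affine /= MN => /addrI uw.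
  by case/eqP: ab; rewrite MN uw.
have /lfunPn[y] := MN; rewrite -subr_eq0 => /functional_neq0[psi psi1].
apply: (@sub_thin _ _ _ [set x | ((psi \o (M - N))%VF x : R) = psi (w - u)]).
  move=> x /=; rewrite /affine /= comp_lfunE add_lfunE opp_lfunE => e.
  congr (psi _); apply: (addIr (N x + u)).
  by rewrite addrA subrK e [N x + u]addrC addrA subrK addrC.
apply: thin_hyperplane; apply/lfunPn; exists y.
by rewrite comp_lfunE add_lfunE opp_lfunE psi1 zero_lfunE oner_eq0.
Qed.

Variable f : V -> W.
Hypothesis plf : piecewise_linear f.

Lemma piecewise_linear_selection : exists s : seq ('Hom(V, W) * W),
  forall x, exists2 a, a \in s & f x = affine a x.
Proof.
have [m [A [_ Acov /boolp.choice[M]]]] := plf.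
move=> /boolp.choice[b fE].
exists [seq (M i, b i) | i <- enum 'I_m] => x.
have [i _ Ax] : (\bigcup_i A i) x by rewrite -Acov.
by exists (M i, b i); [exact/map_f/mem_enum|exact: fE].
Qed.

(** This takes the place of continuity of [f]: on each of the finitely many closed pieces, agreement
    with [a] is an affine equation in [t]. *)
Lemma closed_line_affine (a : 'Hom(V, W) * W) (x v : V) :
  closed [set t : R | f (x + t *: v) = affine a (x + t *: v)].
Proof.
have [m [A [Ap Acov /boolp.choice[M]]]] := plf.
move=> /boolp.choice[b fE].
have -> : [set t : R | f (x + t *: v) = affine a (x + t *: v)] =
  \bigcup_i ([set t : R | A i (x + t *: v)] `&`
    [set t : R | (affine (M i, b i) x - affine a x) +
                 t *: (M i v - a.1 v) = 0]).
  have E i t : (affine (M i, b i) x - affine a x) + t *: (M i v - a.1 v) =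
      affine (M i, b i) (x + t *: v) - affine a (x + t *: v).
    by rewrite !affine_line /= scalerBr (opprD (affine a x)) addrACA.
  apply/seteqP; split=> t.
    move=> /= ft; have [i _ Ax] : (\bigcup_i A i) (x + t *: v) by rewrite -Acov.
    exists i => //; split=> //.
    by apply: etrans (E i t) _; rewrite -ft (fE i _ Ax) subrr.
  by move=> [i _ [/= Ax]]; rewrite E (fE i) // => /subr0_eq.
apply: closed_bigcup => [|i _]; first exact: finite_finset.
apply: closedI.
  exact: closed_line_polyhedral.
exact: closed_line_lfun0.
Qed.

End PiecewiseLinearOnLines.

(** * Components of compact spaces *)

Section Topology.
Variable R : realType.

Lemma clopen_shrink (T : topologicalType) (x : T) (V : set T) :
  compact [set: T] -> open V ->
  (forall y, (forall C, clopen C -> C x -> C y) -> V y) ->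
  exists C, [/\ clopen C, C x & C `<=` V].
Proof.
move=> /compact_near_coveringP cT oV QV.
pose F := filter_from [set C : set T | clopen C /\ C x] id.
have FF : Filter F.
  apply: filter_from_filter; first by exists setT; split => //; exact: clopenT.
  by move=> A B [? ?] [? ?]; exists (A `&` B) => //; split=> //; exact: clopenI.
(* [F] is the filter of points generated by the clopen sets around [x]. Tying the index to the
   covered point by [i = z] makes the near-covering property say that one such clopen set lies in
   [V]. *)
have : \forall i \near F, [set: T] `<=` (fun z => i = z -> V z).
  apply: cT => y _; have [Vy|Vy] := pselect (V y).
    exists (V, setT) => /=; last by move=> [a b] [/= Va _] _.
    by split; [exact: open_nbhs_nbhs|exact: filterT].
  have [C [cC Cx Cy]] : exists C, [/\ clopen C, C x & ~ C y].
    apply: contrapT => nC; apply: Vy; apply: QV => C cC Cx.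
    by apply: contrapT => Cy; apply: nC; exists C.
  exists (~` C, C) => /=; last by move=> [a b] [/= Ca Cb] ba; case: Ca; rewrite -ba.
  split; last by exists C.
  by apply: open_nbhs_nbhs; split=> //; apply: closed_openC; case: cC.
move=> [C [cC Cx] CV]; exists C; split=> // z Cz; exact: (CV z Cz z I).
Qed.

(** In a compact Hausdorff space quasi-components are connected. A splitting of [Q] into closed
    parts would be separated by open sets [U] and [V]; a clopen [C] inside their union is cut by [U]
    into a clopen set that contains [x] and misses the other part. *)
Lemma quasi_component_sub (T : topologicalType) (x y : T) :
  hausdorff_space T -> compact [set: T] ->
  (forall C, clopen C -> C x -> C y) -> connected_component [set: T] x y.
Proof.
move=> hT cT; pose Q := [set z : T | forall C, clopen C -> C x -> C z].
have Qx : Q x by [].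
have closedQ : closed Q.
  have -> : Q = \bigcap_(C in [set C : set T | clopen C /\ C x]) C.
    by apply/seteqP; split=> [z Qz C [cC Cx]|z Qz C cC Cx]; apply: Qz.
  by apply: closed_bigI => C [[_ ?] _].
suff cQ : connected Q by apply: (@connected_component_max _ _ Q).
apply: contrapT => /connectedPn[E [E0 QE [sE sE']]].
have closedE b : closed (E b).
  have EQ : closure (E b) `<=` Q.
    rewrite (closure_id Q).1 //; apply: closureS; rewrite QE.
    by case: b; [right|left].
  move=> z Ez; have := EQ z Ez; rewrite QE.
  case: b {EQ} Ez => Ez [] // Ez'; exfalso.
    suff : (E false `&` closure (E true)) z by rewrite sE'.
    by [].
  suff : (closure (E false) `&` E true) z by rewrite sE.
  by [].
have [b Ebx] : exists b, E b x.
  by have := Qx; rewrite QE => -[]; [exists false|exists true].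
have /normal_openP nT := compact_normal hT cT.
have Edisj : E b `&` E (~~ b) = set0.
  apply/seteqP; split => // z [Ez Ez']; rewrite -sE.
  by case: b {Ebx} Ez Ez' => Ez Ez'; split=> //; exact: subset_closure.
have [U [V [oU oV EU EV UV]]] := nT R _ _ (closedE b) (closedE (~~ b)) Edisj.
have [||C [[oC cC] Cx CUV]] := @clopen_shrink T x (U `|` V) cT.
- exact: openU.
- move=> z Qz; have : Q z by []; rewrite QE.
  by case: b {Ebx Edisj} EU EV => EU EV [] Ez; by [left; exact: EU|right; exact: EV].
have [z Ez] := E0 (~~ b).
have Qz : Q z by rewrite QE; case: b {Ebx Edisj EU EV} Ez; [left|right].
(* The left side is open and the right side is closed. *)
have UCV : C `&` U = C `&` ~` V.
  apply/seteqP; split=> w [Cw]; [move=> Uw; split=> // Vw|].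
    suff : (U `&` V) w by rewrite UV.
    by [].
  by move=> Vw; split=> //; have [|/Vw] := CUV w Cw.
have : (C `&` U) z.
  apply: Qz; last by split=> //; exact: EU.
  split; first exact: openI.
  by rewrite UCV; apply: closedI => //; exact: open_closedC.
by rewrite UCV => -[_]; apply; exact: EV.
Qed.

(** Applied to translations, inversion and conjugation, this makes the identity component a normal
    subgroup. *)
Lemma component_stable (T : topologicalType) (F : T -> T) (x y : T) :
  continuous F -> connected_component [set: T] x (F x) ->
  connected_component [set: T] x y -> connected_component [set: T] x (F y).
Proof.
move=> cF xFx [C [Cx _ cC] Cy]; apply: connected_component_trans xFx _.
exists (F @` C); last by exists y.
split=> //.
apply: connected_continuous_connected => //.
exact: continuous_subspaceT.
Qed.

Lemma connected_finite_range (T : topologicalType) (A : set T) (c : T -> R)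
    (s : seq R) (x y : T) : connected A -> continuous c ->
  (forall z, A z -> c z \in s) -> A x -> A y -> c x = c y.
Proof.
move=> cA cc cs Ax Ay.
suff : A `&` c @^-1` [set c x] = A by move/seteqP => [_ /(_ y Ay)] [].
apply: cA; first by exists x.
  exists (~` (c @^-1` [set` [seq r <- s | r != c x]])).
    rewrite openC; apply: closed_comp => [t _|]; first exact: cc.
    apply: (iffLR accessible_finite_set_closed); last exact: finite_seq.
    exact/hausdorff_accessible/Rhausdorff.
  apply/seteqP; split=> z [Az cz]; split=> //.
    by move: cz; rewrite /preimage /= => ->; rewrite mem_filter eqxx.
  apply: contrapT => /eqP czx; apply: cz.
  by rewrite /preimage /= mem_filter czx cs.
exists (c @^-1` [set c x]) => //.
apply: closed_comp => [t _|]; first exact: cc.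
exact: closed_eq.
Qed.

Lemma compact_continuous_bound (T : topologicalType) (c : T -> R) :
  compact [set: T] -> continuous c -> exists M, forall x, `|c x| <= M.
Proof.
move=> cT cc; have : bounded_set (c @` [set: T]).
  apply: (@compact_bounded _ R^o); apply: continuous_compact => //.
  exact: continuous_subspaceT.
move=> [M [Mreal /(_ (M + 1))]]; rewrite ltrDl ltr01 => /(_ isT) bM.
by exists (M + 1) => x; apply: bM; exists x.
Qed.

Lemma compact_locally_constant (T : topologicalType) (W : eqType) (f : T -> W) :
  compact [set: T] -> (forall x, \forall y \near x, f y = f x) ->
  exists s : seq W, forall x, f x \in s.
Proof.
move=> /compact_near_coveringP cT lf.
(* A property holds eventually along [F] when it holds for all lists containing some fixed list. *)
pose F := filter_from [set: seq W]
  (fun s : seq W => [set r : seq W | {subset s <= r}]).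
have FF : Filter F.
  apply: filter_from_filter; first by exists [::].
  move=> s r _ _; exists (s ++ r) => // u su; split=> w ws; apply: su;
    by rewrite mem_cat ws ?orbT.
have [s _ /(_ s)] : \forall s \near F, [set: T] `<=` (fun x => f x \in (s : seq W)).
  apply: cT => x _; exists ([set y | f y = f x], [set s : seq W | f x \in s]) => /=.
    split; first exact: lf.
    by exists [:: f x] => // s; apply; rewrite mem_head.
  by move=> [y s] /= [->].
by move=> sT; exists s => x; apply: sT.
Qed.

End Topology.

(** Bernoulli's inequality makes the powers of [x > 1] grow at least linearly. *)
Lemma exprn_bounded_le1 (R : realType) (x M : R) :
  (forall n : nat, x ^+ n <= M) -> x <= 1.
Proof.
move=> xM; rewrite leNgt; apply/negP => x1.
have bern n : 1 + (x - 1) *+ n <= x ^+ n.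
  elim: n => [|n IH]; first by rewrite mulr0n addr0 expr0.
  have := ler_wpM2l (ltW (lt_trans ltr01 x1)) IH; rewrite -exprS; apply: le_trans.
  have h : 0 <= (x - 1) * ((x - 1) *+ n).
    by rewrite mulr_ge0 ?mulrn_wge0 // subr_ge0 ltW.
  rewrite mulrS; nra.
have x1' : 0 < x - 1 by rewrite subr_gt0.
have := Num.Theory.archi_boundP (normr_ge0 (M / (x - 1))).
set n := Num.bound _ => hn.
have : M < 1 + (x - 1) *+ n.
  rewrite -[_ *+ n]mulr_natr -ltrBlDl.
  have : M / (x - 1) < n%:R by apply: le_lt_trans hn; exact: ler_norm.
  by rewrite ltr_pdivrMr // mulrC => h; apply: lt_trans h; rewrite ltrBlDl ltrDr.
by move=> /lt_le_trans/(_ (bern n))/lt_le_trans/(_ (xM n)); rewrite ltxx.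
Qed.

(** * Continuous representations *)

Lemma continuous_sum (R : realType) (T : topologicalType) (I : finType)
    (F : I -> T -> R) :
  (forall i, continuous (F i)) -> continuous (fun x => \sum_i F i x).
Proof.
move=> cF; apply: (@continuous_big R^o I +%R 0) => [|i _]; last exact: cF.
exact: add_continuous.
Qed.

Section Representations.
Context {R : realType} {G : topologicalGroupType}.
Hypothesis compactG : compact_group G.

Lemma mulgl_continuous (g : G) : continuous (fun x : G => (g * x)%g).
Proof.
move=> x; apply: (@continuous_comp _ _ _ (fun x : G => (g, x))
  (fun p : G * G => (p.1 * p.2)%g)); last exact: mulg_continuous.
by apply: cvg_pair; [exact: cvg_cst|exact: cvg_id].
Qed.

Lemma mulgr_continuous (g : G) : continuous (fun x : G => (x * g)%g).
Proof.
move=> x; apply: (@continuous_comp _ _ _ (fun x : G => (x, g))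
  (fun p : G * G => (p.1 * p.2)%g)); last exact: mulg_continuous.
by apply: cvg_pair; [exact: cvg_id|exact: cvg_cst].
Qed.

Lemma identity_component1 : identity_component G 1%g.
Proof. exact: connected_component_refl. Qed.

Lemma identity_componentM (g h : G) : identity_component G g ->
  identity_component G h -> identity_component G (g * h)%g.
Proof.
move=> Gg Gh; apply: (@component_stable _ (fun x => (g * x)%g)) => //.
  exact: mulgl_continuous.
by rewrite mulg1.
Qed.

Lemma identity_componentV (g : G) : identity_component G g ->
  identity_component G g^-1%g.
Proof.
move=> Gg; apply: (@component_stable _ (fun x : G => x^-1%g)) => //.
  exact: invg_continuous.
by rewrite invg1; exact: identity_component1.
Qed.

Lemma identity_component_conj (g h : G) : identity_component G g ->
  identity_component G (h * g * h^-1)%g.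
Proof.
move=> Gg; apply: (@component_stable _ (fun x : G => (h * x * h^-1)%g)) => //.
  move=> x; apply: (@continuous_comp _ _ _ (fun y : G => (h * y)%g)
    (fun y : G => (y * h^-1)%g)); first exact: mulgl_continuous.
  exact: mulgr_continuous.
by rewrite mulg1 mulgV; exact: identity_component1.
Qed.

Section OneRepresentation.
Variables (V : vectType R) (rho : representation G V).

Lemma reprM (g h : G) (x : V) : rho (g * h)%g x = rho g (rho h x).
Proof. by rewrite repr_M comp_lfunE. Qed.

Lemma reprKV (g : G) (x : V) : rho g (rho g^-1%g x) = x.
Proof. by rewrite -reprM mulgV repr_1 id_lfunE. Qed.

Lemma reprVK (g : G) (x : V) : rho g^-1%g (rho g x) = x.
Proof. by rewrite -reprM mulVg repr_1 id_lfunE. Qed.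

Lemma repr_coef_continuous (phi : 'Hom(V, R^o)) (x : V) :
  continuous (fun g : G => phi (rho g x) : R).
Proof.
pose e := vbasis {:V}.
have eB : basis_of {:V} e by exact: vbasisP.
have E g : (phi (rho g x) : R) = \sum_j
    (\sum_i coord e i x * (passmx.mxof e e (rho g)) i j) * phi e`_j.
  rewrite {1}(coord_vbasis (memvf (rho g x))) linear_sum; apply: eq_bigr => j _.
  rewrite linearZ /=; congr (_ * _).
  rewrite passmx.coord_rVof (passmx.rVof_app e eB) mxE; apply: eq_bigr => i _.
  by rewrite mxE.
have -> : (fun g : G => phi (rho g x) : R) = fun g => \sum_j
    (\sum_i coord e i x * (passmx.mxof e e (rho g)) i j) * phi e`_j.
  by apply/funext.
apply: continuous_sum => j g; apply: cvgM; last exact: cvg_cst.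
move: g; apply: continuous_sum => i g; apply: cvgM; first exact: cvg_cst.
apply: (@continuous_comp _ _ _ (fun g => passmx.mxof e e (rho g))
  (fun A : 'M[R]_(_, _) => A i j)); first exact: repr_continuous.
exact: coord_continuous.
Qed.

End OneRepresentation.

(** Expanding [rho g^-1 x] in a basis writes the function as a finite sum of products of matrix
    coefficients. *)
Lemma repr_conj_continuous (V W : vectType R) (rho : representation G V)
    (sigma : representation G W) (M : 'Hom(V, W))
    (psi : 'Hom(W, R^o)) (x : V) :
  continuous (fun g : G => psi (sigma g (M (rho g^-1%g x))) : R).
Proof.
pose e := vbasis {:V}.
pose c i : 'Hom(V, R^o) := linfun (coord e i : V -> R^o).
have -> : (fun g : G => psi (sigma g (M (rho g^-1%g x))) : R) = fun g =>
    \sum_i (c i (rho g^-1%g x) : R) * psi (sigma g (M e`_i)).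
  apply/funext => g.
  rewrite {1}(coord_vbasis (memvf (rho g^-1%g x))) !linear_sum.
  by apply: eq_bigr => i _; rewrite !linearZ lfunE.
apply: continuous_sum => i g; apply: cvgM; last exact: repr_coef_continuous.
apply: (@continuous_comp _ _ _ (fun g : G => g^-1%g)
  (fun g : G => c i (rho g x) : R)); first exact: invg_continuous.
exact: repr_coef_continuous.
Qed.

End Representations.

(** * Nontrivial action of the identity component *)

Section ComponentActsNontrivially.
Context {R : realType} {G : topologicalGroupType}.
Hypothesis compactG : compact_group G.

(* The eigenvalue is a bounded character, hence 1 or -1, and G° is connected. *)
Lemma component_eigenvector_fixed (W : vectType R) (sigma : representation G W)
    (w : W) : (forall g, identity_component G g -> sigma g w \in <[w]>%VS) ->
  forall g, identity_component G g -> sigma g w = w.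
Proof.
have [->|w0] := eqVneq w 0; first by move=> _ g _; rewrite linear0.
move=> wline; have [psi psiw] := functional_neq0 w0.
pose c (g : G) : R := psi (sigma g w).
have cE g : identity_component G g -> sigma g w = c g *: w.
  by move=> /wline/vlineP[k kw]; rewrite /c kw linearZ /= psiw /GRing.scale /= mulr1.
have cM g h : identity_component G h -> c (g * h)%g = c h * c g.
  by move=> Gh; rewrite {1}/c reprM (cE h Gh) !linearZ.
have c1 : c 1%g = 1 by rewrite /c repr_1 id_lfunE.
have cX g n : identity_component G g -> c (g ^+ n)%g = c g ^+ n.
  move=> Gg; elim: n => [|n IH]; first by rewrite expg0 expr0 c1.
  by rewrite expgSr exprS cM // IH.
have cc : continuous c by exact: repr_coef_continuous.
have [M cbound] := compact_continuous_bound compactG.2 cc.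
have cle1 g : identity_component G g -> `|c g| <= 1.
  move=> Gg; apply: (@exprn_bounded_le1 _ _ M) => n.
  by rewrite -normrX -cX.
have cpm g : identity_component G g -> c g \in [:: 1; -1].
  move=> Gg; have GV := identity_componentV Gg.
  have e : c g * c g^-1%g = 1 by rewrite -cM // mulVg.
  have ng : `|c g| = 1.
    (* Both [c g] and [c g^-1] have absolute value at most 1, and their product is 1. *)
    apply/eqP; rewrite eq_le cle1 //= -[X in X <= _](normr1 R) -e normrM.
    by rewrite ler_piMr // cle1.
  have : c g ^+ 2 == 1 by rewrite -real_normK ?num_real // ng expr1n.
  by rewrite sqrf_eq1 !inE.
move=> g Gg; rewrite cE //.
rewrite (@connected_finite_range R G (identity_component G) c [:: 1; -1] g 1%g) //.
- by rewrite c1 scale1r.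
- exact: component_connected.
- exact: identity_component1.
Qed.

Section FromIrreducible.
Variables (L : vectType R) (rhoL : representation G L).
Hypothesis irrL : irreducible rhoL.
Hypothesis nontrivial : ~ acts_trivially rhoL (identity_component G).

(* The common kernel of all such [D] is G-stable, because G° is normal; it
   contains every [rhoL g x - x] with g in G°, so it is not 0. *)
Lemma component_invariant_hom_eq0 (W : vectType R) (D : 'Hom(L, W)) :
  (forall g, identity_component G g -> forall x, D (rhoL g x) = D x) -> D = 0.
Proof.
pose inv (D : 'Hom(L, W)) :=
  forall g, identity_component G g -> forall x, D (rhoL g x) = D x.
have [||U UP] := @vspace_of_linear_closed _ L (fun x => forall D, inv D -> D x = 0).
- by move=> D' _; rewrite linear0.
- by move=> a x y Px Py D' iD; rewrite linearP /= Px // Py // scaler0 addr0.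
move=> iD; have [|U0|U1] := irrL.2 U.
- move=> h; apply/subvP => _ /memv_imgP[x xU ->].
  apply/(UP (rhoL h x)) => D' iD'; rewrite -comp_lfunE.
  apply: (UP x).1 => // g Gg y; rewrite !comp_lfunE.
  rewrite -[in RHS](iD' _ (identity_component_conj h Gg)).
  by rewrite !reprM reprVK.
- case: nontrivial => g Gg x; apply/eqP; rewrite -subr_eq0 -memv0 -U0.
  by apply/UP => D' iD'; rewrite linearB /= iD' // subrr.
- apply/lfunP => x; rewrite zero_lfunE; apply: (UP x).1 => //.
  by rewrite U1 memvf.
Qed.

Variables (K : vectType R) (rhoK : representation G K).

(** A nonzero [D x] spans the line of [e], and G° keeps it in that line by equivariance, so it is an
    eigenvector and hence fixed. Thus [D] is G°-invariant and must vanish. *)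
Lemma component_equivariant_line_eq0 (D : 'Hom(L, K)) (e : K) :
  (forall g, identity_component G g -> forall x, rhoK g (D x) = D (rhoL g x)) ->
  (forall x, D x \in <[e]>%VS) -> D = 0.
Proof.
move=> eqD De; apply: component_invariant_hom_eq0 => g Gg x.
rewrite -eqD //; apply: component_eigenvector_fixed Gg => h Gh.
have [->|Dx0] := eqVneq (D x) 0; first by rewrite linear0 mem0v.
rewrite eqD //; have /vlineP[a ae] := De x.
have /vlineP[b ->] := De (rhoL h x).
have a0 : a != 0 by apply: contraNneq Dx0 => a0; rewrite ae a0 scale0r.
by apply/vlineP; exists (b / a); rewrite ae scalerA divfK.
Qed.

Lemma affine_inj (a b : 'Hom(L, K) * K) :
  (forall x, affine a x = affine b x) -> a = b.
Proof.
move=> ab; apply: contrapT => /eqP/thin_affine_eq tab.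
by apply: (@not_thinT R L); apply: sub_thin tab => x _; exact: ab.
Qed.

(** Through any [x] there is a line with only finitely many exceptions to [P]; closedness along this
    line removes them. *)
Lemma closed_lines_cothin (P : set L) :
  (forall x v, closed [set t : R | P (x + t *: v)]) -> thin (~` P) ->
  forall x, P x.
Proof.
move=> cP /thin_line[v tv] x; have [s sP] := tv x.
suff : [set t : R | P (x + t *: v)] 0 by rewrite /= scale0r addr0.
apply: (closed_cofinite (s := s)) => // t ts.
by apply: contrapT => /sP; rewrite (negPf ts).
Qed.

(** A coincidence on the line through [x0] and [y] means [t *: D (y - x0) = e], where [e] is the
    nonzero gap at [x0]. If [D] is not 0, its image is not contained in the line of [e], so a
    functional killing [e] but not all of the image puts [y] on a hyperplane. *)
Lemma thin_line_meets (a b : 'Hom(L, K) * K) (x0 : L) :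
  (forall g, identity_component G g ->
    forall x, rhoK g (a.1 x) = a.1 (rhoL g x)) ->
  (forall g, identity_component G g ->
    forall x, rhoK g (b.1 x) = b.1 (rhoL g x)) ->
  affine a x0 <> affine b x0 ->
  thin [set y | exists t : R,
    affine a (x0 + t *: (y - x0)) = affine b (x0 + t *: (y - x0))].
Proof.
move=> eqa eqb ab0; pose D := a.1 - b.1.
have DE x : D x = a.1 x - b.1 x by rewrite add_lfunE opp_lfunE.
pose e := affine b x0 - affine a x0.
have e0 : e <> 0 by move=> /subr0_eq /esym.
have meet (y : L) (t : R) :
    affine a (x0 + t *: (y - x0)) = affine b (x0 + t *: (y - x0)) ->
    t *: D (y - x0) = e.
  rewrite !affine_line DE scalerBr => ab.
  by apply: (addrI (affine a x0)); rewrite addrA ab addrK /e subrKC.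
have [D0|D0] := eqVneq D 0.
  apply: sub_thin thin0 => y [t /meet].
  by rewrite D0 zero_lfunE scaler0 => /esym.
have [u Du] : exists u, D u \notin <[e]>%VS.
  apply: contrapT => nu; case/eqP: D0.
  apply: (@component_equivariant_line_eq0 _ e) => [g Gg x|x].
    by rewrite !DE linearB /= eqa // eqb.
  by apply: contrapT => /negP Dx; apply: nu; exists x.
have [psi [psi0 psi1]] := functional_separates Du.
apply: (@sub_thin _ _ _ [set y | ((psi \o D)%VF y : R) = psi (D x0)]).
  move=> y [t /meet tD] /=; rewrite comp_lfunE.
  have t0 : t != 0.
    by apply/eqP => t0; apply: e0; rewrite -tD t0 scale0r.
  have := psi0 e (memv_line e); rewrite -tD !linearZ !linearB /=.
  by move=> /eqP; rewrite scaler_eq0 (negPf t0) subr_eq0 => /eqP.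
apply: thin_hyperplane; apply/lfunPn; exists u.
by rewrite comp_lfunE psi1 zero_lfunE oner_eq0.
Qed.

Lemma equivariant_piecewise_linear_affine (f : L -> K) :
  Hom_pl rhoL rhoK f -> exists a, forall x, f x = affine a x.
Proof.
move=> [eqf plf]; have [s sf] := piecewise_linear_selection plf.
(* By equivariance of [f], [conj g a] agrees with [f] at [rhoL g x] whenever [a] agrees with [f] at
   [x]. *)
pose conj (g : G) (a : 'Hom(L, K) * K) : 'Hom(L, K) * K :=
  ((rhoK g \o a.1 \o rhoL g^-1%g)%VF, rhoK g a.2).
have conjE g a x : affine (conj g a) x = rhoK g (affine a (rhoL g^-1%g x)).
  by rewrite /affine /= !comp_lfunE linearD.
pose essential a := ~ thin [set x | f x = affine a x].
(* An affine map outside [s] can agree with [f] only where it coincides with some member of [s],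
   which is a thin set. *)
have ess_mem a : essential a -> a \in s.
  move=> ess; apply: contrapT => /negP as_; apply: ess.
  apply: (@sub_thin _ _ _
    (\bigcup_(b in [set` s]) [set x | affine b x = affine a x])).
    by move=> x /= fx; have [b bs fb] := sf x; exists b; rewrite //= -fb.
  apply: thin_bigcup => b bs; apply: thin_affine_eq.
  by apply: contraNneq as_ => <-.
have ess_conj g a : essential a -> essential (conj g a).
  move=> ess tg; apply: ess.
  apply: sub_thin (thin_comp_lfun (h := rhoL g) (k := rhoL g^-1%g) _ tg).
    by move=> x /= fx; rewrite /preimage /= -eqf fx conjE reprVK.
  by rewrite -repr_M mulgV repr_1.
pose S := [seq a <- s | `[< essential a >]].
have SP a : a \in S <-> essential a.
  rewrite mem_filter; split; first by move=> /andP[/asboolP].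
  by move=> ess; rewrite ess_mem // andbT; apply/asboolP.
have cover x : exists2 a, a \in S & f x = affine a x.
  pose P := \bigcup_(a in [set` S]) [set x | f x = affine a x].
  suff : P x by move=> [a aS fa]; exists a.
  apply: closed_lines_cothin => [y v|].
    have -> : [set t : R | P (y + t *: v)] = \bigcup_(a in [set` S])
        [set t : R | f (y + t *: v) = affine a (y + t *: v)].
      by apply/seteqP; split=> t [a aS fa]; exists a.
    apply: closed_bigcup => [|a _]; first exact: finite_seq.
    exact: closed_line_affine.
  apply: (@sub_thin _ _ _ (\bigcup_(a in [set` [seq a <- s | a \notin S]])
    [set x | f x = affine a x])).
    move=> y nPy; have [a as_ fa] := sf y; exists a => //=.
    rewrite mem_filter as_ andbT; apply/negP => aS; apply: nPy.
    by exists a.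
  apply: thin_bigcup => a; rewrite mem_filter => /andP[/negP aS _].
  by apply: contrapT => ess; apply: aS; apply/SP.
(* Each scalar coefficient of [conj h a] at [x] is continuous in [h] and takes finitely many values,
   since [conj h a] stays in [S]; so it is constant on G°. *)
have fixed g a : identity_component G g -> a \in S -> conj g a = a.
  move=> Gg aS; apply: affine_inj => x; apply: contrapT => /eqP.
  rewrite -subr_eq0 => /functional_neq0[psi psi1].
  pose c (h : G) : R := psi (affine (conj h a) x).
  have cc : continuous c.
    have -> : c = (fun h : G => psi (rhoK h (a.1 (rhoL h^-1%g x))) : R) \+
        (fun h : G => psi (rhoK h a.2) : R).
      by apply/funext => h; rewrite /c conjE /affine !linearD.
    move=> h; apply: cvgD; first exact: repr_conj_continuous.
    exact: repr_coef_continuous.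
  have cE : c g = c 1%g.
    apply: (@connected_finite_range R G (identity_component G) c
      [seq psi (affine b x) : R | b <- S]) => //.
    - exact: component_connected.
    - by move=> h _; apply: map_f; apply/SP/ess_conj/SP.
    - exact: identity_component1.
  have a1 : affine (conj 1%g a) x = affine a x.
    by rewrite conjE invg1 !repr_1 !id_lfunE.
  move: psi1; rewrite linearB /= -a1 [X in X - _]cE subrr.
  by apply/eqP; rewrite eq_sym oner_eq0.
have eqv a : a \in S -> forall g, identity_component G g ->
    forall x, rhoK g (a.1 x) = a.1 (rhoL g x).
  move=> aS g Gg x; have := fixed g a Gg aS.
  move=> /(congr1 (fun b : 'Hom(L, K) * K => b.1 (rhoL g x))) /=.
  by rewrite !comp_lfunE reprVK.
pose pairs := [seq p <- [seq (a, b) | a <- S, b <- S] | p.1 != p.2].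
have pairsP a b : a \in S -> b \in S -> a != b -> (a, b) \in pairs.
  by move=> aS bS ab; rewrite mem_filter /= ab; apply: allpairs_f.
have inS p : p \in pairs -> [/\ p.1 != p.2, p.1 \in S & p.2 \in S].
  by rewrite mem_filter => /andP[p12 /allpairsP[q [? ? E]]]; move: p12; rewrite E.
(* The base point avoids every coincidence locus of two distinct members of [S]; the map [a0] that
   [f] follows at [x0] is then shown to be [f] everywhere. *)
have [x0 x0P] : exists x0,
    forall p, p \in pairs -> affine p.1 x0 <> affine p.2 x0.
  apply: contrapT => nx; apply: (@not_thinT R L).
  apply: (@sub_thin _ _ _ (\bigcup_(p in [set` pairs])
      [set x | affine p.1 x = affine p.2 x])).
    move=> x _; apply: contrapT => xp; apply: nx; exists x => p pS pE.
    by apply: xp; exists p.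
  by apply: thin_bigcup => p /inS[p12 _ _]; exact: thin_affine_eq.
have [a0 a0S fa0] := cover x0; exists a0.
apply: closed_lines_cothin => [x v|]; first exact: closed_line_affine.
apply: (@sub_thin _ _ _ (\bigcup_(p in [set` pairs])
    [set y | exists t : R, affine p.1 (x0 + t *: (y - x0)) =
                           affine p.2 (x0 + t *: (y - x0))])); last first.
  apply: thin_bigcup => p pS; have [_ p1 p2] := inS p pS.
  by apply: thin_line_meets; [exact: eqv|exact: eqv|exact: x0P].
move=> y; apply: contra_notP => ny.
pose l (t : R) := x0 + t *: (y - x0).
have meet a b t : a \in S -> b \in S ->
    affine a (l t) = affine b (l t) -> a = b.
  move=> aS bS ab; apply: contrapT => /eqP/(pairsP _ _ aS bS) abS.
  by apply: ny; exists (a, b) => //; exists t.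
pose C := [set t : R | f (l t) = affine a0 (l t)].
pose C' := \bigcup_(a in [set` [seq a <- S | a != a0]])
  [set t : R | f (l t) = affine a (l t)].
(* On this line distinct members of [S] never coincide, so [C] and [C'] are disjoint closed sets
   covering the connected real line, and 0 lies in [C]. *)
have CT : C = [set: R].
  have : connected [set: R] by apply/connected_intervalP.
  apply.
  - by exists 0; rewrite /C /l /= scale0r addr0.
  - exists (~` C').
      rewrite openC; apply: closed_bigcup => [|a _]; first exact: finite_seq.
      exact: closed_line_affine.
    rewrite setTI; apply/seteqP; split=> t.
      move=> Ct [a]; rewrite /= mem_filter => /andP[/eqP aa0 aS] fa.
      by apply: aa0; apply: (meet _ _ t) => //; rewrite -fa.
    move=> nC; have [a aS fa] := cover (l t).
    have [aa0|aa0] := eqVneq a a0; first by rewrite /C /= -aa0.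
    by case: nC; exists a => //=; rewrite mem_filter aa0.
  - exists C; last by rewrite setTI.
    exact: closed_line_affine.
(* The parameter 1 corresponds to the point [y]. *)
have : C 1 by rewrite CT.
by rewrite /C /l /= scale1r subrKC.
Qed.

End FromIrreducible.
End ComponentActsNontrivially.

(** * Finiteness of the image *)

Section NoSmallSubgroups.
Context {R : realType} {n : nat}.

(** The entrywise sum is preferred to the maximum because it is submultiplicative with constant
    1. *)
Definition mx_sum_norm (A : 'M[R]_n) : R := \sum_i \sum_j `|A i j|.

Lemma mx_sum_norm_ge0 (A : 'M[R]_n) : 0 <= mx_sum_norm A.
Proof. by apply: sumr_ge0 => i _; apply: sumr_ge0. Qed.

Lemma mx_sum_norm_eq0 (A : 'M[R]_n) : mx_sum_norm A = 0 -> A = 0.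
Proof.
move=> /eqP; rewrite psumr_eq0 => [/allP A0|i _]; last exact: sumr_ge0.
apply/matrixP => i j; have := A0 i (mem_index_enum i).
rewrite /= psumr_eq0 // => /allP/(_ j (mem_index_enum j)) /=.
by rewrite normr_eq0 mxE => /eqP.
Qed.

Lemma mx_sum_normB (A B : 'M[R]_n) :
  mx_sum_norm (A - B) <= mx_sum_norm A + mx_sum_norm B.
Proof.
rewrite -big_split /=; apply: ler_sum => i _.
rewrite -big_split /=; apply: ler_sum => j _.
by rewrite !mxE; exact: ler_normB.
Qed.

Lemma mx_sum_norm_double (A : 'M[R]_n) :
  mx_sum_norm (A + A) = 2 * mx_sum_norm A.
Proof.
rewrite mulr_sumr; apply: eq_bigr => i _; rewrite mulr_sumr.
by apply: eq_bigr => j _; rewrite mxE -mulr2n normrMn mulr_natl.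
Qed.

Lemma mx_sum_normM (A B : 'M[R]_n) :
  mx_sum_norm (A *m B) <= mx_sum_norm A * mx_sum_norm B.
Proof.
rewrite mulr_suml; apply: ler_sum => i _.
apply: (@le_trans _ _ (\sum_j \sum_k `|A i k| * `|B k j|)).
  apply: ler_sum => j _; rewrite mxE; apply: le_trans (ler_norm_sum _ _ _) _.
  by apply: ler_sum => k _; rewrite normrM.
rewrite exchange_big mulr_suml; apply: ler_sum => k _.
rewrite -mulr_sumr; apply: ler_wpM2l => //.
rewrite /mx_sum_norm [leRHS](bigD1 k) //= lerDl.
by apply: sumr_ge0 => l _; apply: sumr_ge0.
Qed.

(* Squaring [1 + X] gives [1 + (2 X + X^2)], so near [1] it moves a matrix away
   from [1] by a factor at least [3/2]. *)
Lemma squaring_near1_eq1 (P : set 'M[R]_n) :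
  (forall A, P A -> P (A *m A)) ->
  (forall A, P A -> mx_sum_norm (A - 1%:M) <= 2^-1) ->
  forall A, P A -> A = 1%:M.
Proof.
move=> Psq Pnear A PA; apply/subr0_eq/mx_sum_norm_eq0.
have expand (B : 'M[R]_n) : P B ->
    3 / 2 * mx_sum_norm (B - 1%:M) <= mx_sum_norm (B *m B - 1%:M).
  move=> PB; set X := B - 1%:M.
  have XX : X + X = (B *m B - 1%:M) - X *m X.
    rewrite /X mulmxBl mulmxBr !mul1mx mulmx1.
    apply/matrixP => i j; rewrite !mxE; ring.
  (* The norm of [X] is at most 1/2, so that of [X *m X] is at most half the norm of [X]; the factor
     is 2 - 1/2 = 3/2. *)
  have := mx_sum_normB (B *m B - 1%:M) (X *m X).
  rewrite -XX mx_sum_norm_double => le2.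
  have := mx_sum_normM X X; have := Pnear B PB; rewrite -/X.
  have := mx_sum_norm_ge0 X; nra.
have grow k : forall B, P B -> (3 / 2) ^+ k * mx_sum_norm (B - 1%:M) <= 2^-1.
  elim: k => [|k IH] B PB; first by rewrite expr0 mul1r; exact: Pnear.
  rewrite exprSr -mulrA; apply: le_trans (IH _ (Psq _ PB)).
  by apply: ler_wpM2l; [rewrite exprn_ge0 //|exact: expand].
apply: contrapT => /eqP X0.
have Xpos : 0 < mx_sum_norm (A - 1%:M) by rewrite lt0r X0 mx_sum_norm_ge0.
have : (3 / 2 : R) <= 1.
  apply: (@exprn_bounded_le1 _ _ (2^-1 / mx_sum_norm (A - 1%:M))) => k.
  by rewrite ler_pdivlMr //; exact: grow.
lra.
Qed.

End NoSmallSubgroups.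

Section FiniteImage.
Context {R : realType} {G : topologicalGroupType}.
Hypothesis compactG : compact_group G.
Variables (V : vectType R) (rho : representation G V).
Hypothesis trivial : acts_trivially rho (identity_component G).

Lemma repr_trivial_near1 : \forall g \near (1%g : G), rho g = \1%VF.
Proof.
pose e := vbasis {:V}.
have eB : basis_of {:V} e by exact: vbasisP.
pose m (g : G) := passmx.mxof e e (rho g).
have m1 : passmx.mxof e e \1%VF = 1%:M by rewrite passmx.mxof1 ?(basis_free eB).
(* The matrices act on row vectors, which reverses products. *)
have mM g h : m (g * h)%g = m h *m m g.
  by rewrite /m repr_M (passmx.mxof_comp e e eB).
pose c (g : G) := mx_sum_norm (m g - 1%:M).
have cc : continuous c.
  apply: continuous_sum => i; apply: continuous_sum => j.
  have -> : (fun g : G => `|(m g - 1%:M) i j|) =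
      (fun g : G => `|m g i j - (1%:M : 'M[R]_(\dim {:V})) i j|).
    by apply/funext => g; rewrite !mxE.
  move=> g; apply: cvg_norm; apply: cvgB; last exact: cvg_cst.
  apply: (@continuous_comp _ _ _ m (fun A : 'M[R]_(_, _) => A i j)).
    exact: repr_continuous.
  exact: coord_continuous.
have [||C [[oC cC] C1 CV]] :=
    @clopen_shrink G 1%g (c @^-1` [set r | r < 2^-1]) compactG.2.
- by apply: open_comp; [move=> g _; exact: cc|exact: open_lt].
- move=> y /(@quasi_component_sub R _ _ _ compactG.1 compactG.2) /trivial ty.
  have r1 : rho y = \1%VF by apply/lfunP => x; rewrite ty id_lfunE.
  rewrite /preimage /= /c /m r1 m1 subrr /mx_sum_norm big1 ?invr_gt0 // => i _.
  by rewrite big1 // => j _; rewrite mxE normr0.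
have /compact_near_coveringP cptC : compact C.
  exact: (subclosed_compact cC compactG.2).
(* Compactness of [C] makes the neighbourhood of 1 uniform in [x]. Starting from 1 in [C], all
   powers of such a [g] then stay in [C]. *)
have : \forall g \near (1%g : G), C `<=` (fun x => C (g * x)%g).
  apply: cptC => x Cx.
  have : nbhs ((1%g : G), x) [set p | C (p.1 * p.2)%g].
    apply: (@mulg_continuous G ((1%g : G), x)).
    by rewrite /= mul1g; exact: open_nbhs_nbhs.
  move=> [[U W] [/= U1 Wx] UW]; exists (W, U) => //= -[a b] [/= Wa Ub].
  exact: (UW (b, a)).
apply: filterS => g gC.
have Cg n : C (g ^+ n)%g.
  by elim: n => [|n IH]; [rewrite expg0|rewrite expgS; exact: gC].
apply: (can_inj (passmx.mxofK eB eB)); rewrite m1 -/(m g).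
apply: (@squaring_near1_eq1 R _ [set A | exists n, A = m (g ^+ n)%g]).
- by move=> _ [n ->]; exists (n + n)%N; rewrite expgnDr mM.
- by move=> _ [n ->]; exact/ltW/(CV _ (Cg n)).
- by exists 1%N; rewrite expg1.
Qed.

(** Translating the neighbourhood of 1 on which [rho] is trivial shows that [rho] is locally
    constant, and [G] is compact. *)
Lemma repr_finite_image : exists s : seq 'End(V), forall g, rho g \in s.
Proof.
apply: compact_locally_constant; first exact: compactG.2.
move=> x; have : \forall y \near x, rho (x^-1 * y)%g = \1%VF.
  have := @mulgl_continuous G x^-1%g x [set g | rho g = \1%VF].
  by rewrite /= mulVg => /(_ repr_trivial_near1).
apply: filterS => y xy.
by rewrite -[y in LHS](mulVKg x) repr_M xy comp_lfun1r.
Qed.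

End FiniteImage.

(** * Hinge functions and exposed points *)

Section PiecewiseLinearMaps.
Context {R : realType} {V W : vectType R}.

Lemma affine_piecewise_linear (M : 'Hom(V, W)) (b : W) :
  piecewise_linear (fun x => M x + b).
Proof.
exists 1%N, (fun=> setT); split=> [_||_].
- exists 0%N, (fun=> setT); split=> [[]//|].
  by apply/seteqP; split=> // x _ [].
- by apply/seteqP; split=> // x _; exists ord0.
- by exists M, b.
Qed.

Definition rank_one (chi : 'Hom(V, R^o)) (w : W) (x : V) : W := (chi x : R) *: w.

Fact rank_one_linear chi w : linear (rank_one chi w).
Proof.
by move=> a x y; rewrite /rank_one linearP /= scalerDl scalerA.
Qed.

HB.instance Definition _ chi w := GRing.isLinear.Build R V W _ (rank_one chi w)
  (rank_one_linear chi w).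

Lemma hinge_piecewise_linear (chi : 'Hom(V, R^o)) (c : R) (w : W) :
  piecewise_linear (fun x => Num.max 0 ((chi x : R) - c) *: w).
Proof.
(* Half-spaces require a nonzero functional, so the constant case is treated apart. *)
have [->|chi0] := eqVneq chi 0.
  have -> : (fun x : V => Num.max 0 (((0 : 'Hom(V, R^o)) x : R) - c) *: w) =
      (fun x => (0 : 'Hom(V, W)) x + Num.max 0 (- c) *: w).
    by apply/funext => x; rewrite !zero_lfunE !add0r.
  exact: affine_piecewise_linear.
pose A (i : 'I_2) : set V :=
  if i == ord0 then [set x | (chi x : R) <= c] else [set x | ((- chi) x : R) <= - c].
have half (phi : 'Hom(V, R^o)) (d : R) : phi != 0 ->
    convex_polyhedral [set x | (phi x : R) <= d].
  move=> phi0; exists 1%N, (fun=> [set x | (phi x : R) <= d]); split=> [_|].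
    by exists phi, d; split=> //; exact/eqP.
  by apply/seteqP; split=> [x xd _ _ //|x /(_ ord0 I)].
exists 2%N, A; split=> [i||i].
- by rewrite /A; case: ifP => _; apply: half; rewrite ?oppr_eq0.
- apply/seteqP; split=> // x _; have [xc|cx] := leP (chi x : R) c.
    by exists ord0.
  by exists ord_max => //; rewrite /A /= opp_lfunE lerN2 ltW.
rewrite /A; case: ifP => _.
  exists 0, 0 => x /= xc; rewrite zero_lfunE addr0 max_l ?scale0r //.
  by rewrite subr_le0.
exists (linfun (rank_one chi w)), (- c *: w) => x /=.
rewrite opp_lfunE lerN2 => cx.
by rewrite max_r ?subr_ge0 // lfunE /= /rank_one scalerBl scaleNr.
Qed.

End PiecewiseLinearMaps.

Section ExposedPoint.
Context {R : realType}.

Lemma seq_argmax (T : eqType) (s : seq T) (F : T -> R) : s != [::] ->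
  exists2 x, x \in s & forall y, y \in s -> F y <= F x.
Proof.
elim: s => // a s IH _; have [->|/IH[x xs xmax]] := eqVneq s [::].
  by exists a; [rewrite mem_head|move=> y; rewrite inE => /eqP ->].
have [ax|xa] := leP (F a) (F x).
  exists x; first by rewrite inE xs orbT.
  by move=> y; rewrite inE => /orP[/eqP -> //|/xmax].
exists a; first by rewrite mem_head.
move=> y; rewrite inE => /orP[/eqP -> //|/xmax yx].
exact: le_trans yx (ltW xa).
Qed.

Lemma seq_strict_bound (T : eqType) (s : seq T) (F : T -> R) (m : R) :
  (forall y, y \in s -> F y < m) ->
  exists2 c, c < m & forall y, y \in s -> F y <= c.
Proof.
elim: s => [_|a s IH sm]; first by exists (m - 1) => //; rewrite gtrBl.
have [|c cm sc] := IH; first by move=> y ys; apply: sm; rewrite inE ys orbT.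
exists (Num.max (F a) c); first by rewrite gt_max cm sm ?mem_head.
by move=> y; rewrite inE le_max => /orP[/eqP ->|/sc ->]; rewrite ?lexx ?orbT.
Qed.

(* A point of maximal Euclidean norm is exposed. *)
Lemma finite_exposed_point (V : vectType R) (s : seq V) : s != [::] ->
  exists x (chi : 'Hom(V, R^o)) (c : R), [/\ x \in s, c < (chi x : R) &
    forall y, y \in s -> y != x -> (chi y : R) <= c].
Proof.
move=> s0; pose e := vbasis {:V}.
pose k i : 'Hom(V, R^o) := linfun (coord e i : V -> R^o).
pose dot (x y : V) : R := \sum_i (k i x : R) * k i y.
have [x xs xmax] := seq_argmax (fun x => dot x x) s0.
pose chi : 'Hom(V, R^o) := \sum_i (k i x : R) *: k i.
have chiE y : (chi y : R) = dot x y.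
  by rewrite sum_lfunE; apply: eq_bigr => i _; rewrite scale_lfunE.
have below y : y \in [seq y <- s | y != x] -> (chi y : R) < chi x.
  rewrite mem_filter => /andP[yx ys]; rewrite !chiE.
  (* Expanding this square and using [dot y y <= dot x x] gives [dot x y < dot x x]. *)
  have pos : 0 < dot (x - y) (x - y).
    rewrite lt0r sumr_ge0 ?andbT => [|i _]; last by rewrite -expr2 sqr_ge0.
    apply: contra yx; rewrite psumr_eq0 => [/allP d0|i _]; last first.
      by rewrite -expr2 sqr_ge0.
    rewrite eq_sym -subr_eq0 (coord_vbasis (memvf (x - y))) big1 // => i _.
    have := d0 i (mem_index_enum i); rewrite /= mulf_eq0 orbb lfunE /=.
    by move=> /eqP ->; rewrite scale0r.
  have dE : dot (x - y) (x - y) = dot x x + dot y y - 2 * dot x y.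
    rewrite /dot mulr_sumr -big_split -sumrB /=; apply: eq_bigr => i _.
    rewrite linearB /=; ring.
  have := xmax y ys; rewrite dE in pos; lra.
have [c cx bc] := seq_strict_bound below.
exists x, chi, c; split=> // y ys yx.
by apply: bc; rewrite mem_filter yx.
Qed.

End ExposedPoint.

(** * Equivariant piecewise linear maps *)

Section TrivialRepresentation.
Context {R : realType} (G : topologicalGroupType) (V : vectType R).

Definition const_id_fun (_ : G) : 'End(V) := \1%VF.

Fact const_id_fun_M (g h : G) :
  const_id_fun (g * h)%g = (const_id_fun g \o const_id_fun h)%VF.
Proof. by rewrite /const_id_fun comp_lfun1l. Qed.

Fact const_id_fun_continuous : continuous
  (fun g => passmx.mxof (vbasis {:V}) (vbasis {:V}) (const_id_fun g)).
Proof. by move=> g; exact: cvg_cst. Qed.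

Definition const_id_repr : representation G V :=
  Representation (erefl _) const_id_fun_M const_id_fun_continuous.

End TrivialRepresentation.

Section Equivariance.
Context {R : realType} {G : topologicalGroupType} {L K : vectType R}.
Variables (rhoL : representation G L) (rhoK : representation G K).

(* [Hom_pl_linear] for trivial actions, where equivariance is void. *)
Lemma piecewise_linear_sum (I : Type) (s : seq I) (F : I -> L -> K) :
  (forall i, piecewise_linear (F i)) ->
  piecewise_linear (fun x => \sum_(i <- s) F i x).
Proof.
move=> plF.
suff [] : Hom_pl (const_id_repr G L) (const_id_repr G K)
    (fun x => \sum_(i <- s) F i x) by [].
elim: s => [|i s IH].
  have -> : (fun x : L => \sum_(i <- [::]) F i x) = 0.
    by apply/funext => x; rewrite big_nil.
  exact: Hom_pl0.
have -> : (fun x => \sum_(j <- i :: s) F j x) =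
    1 *: F i + (fun x => \sum_(j <- s) F j x).
  by apply/funext => x; rewrite big_cons -[F i x]scale1r.
apply: Hom_pl_linear => //; split=> [g l|]; last exact: plF.
by rewrite /= !id_lfunE.
Qed.

Lemma Hom_pl_neq0 : Hom_pl rhoL rhoK <> [set 0] <->
  exists f x, Hom_pl rhoL rhoK f /\ f x <> 0.
Proof.
split=> [H0|[f [x [Hf fx]]] H0]; last first.
  have f0 : [set (0 : L -> K)] f by rewrite -H0.
  by apply: fx; rewrite f0.
apply: contrapT => nf; apply: H0; apply/seteqP; split=> [f Hf|_ ->].
  apply/funext => x; apply: contrapT => fx; apply: nf.
  by exists f, x.
exact: Hom_pl0.
Qed.

(** The vectors of [K] fixed by the kernel of [rhoL] form a subspace, which is stable because the
    kernel is normal. It contains [f x], so irreducibility makes it all of [K]. *)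
Lemma equivariant_repr_ker_sub (f : L -> K) (x : L) :
  irreducible rhoK -> equivariant rhoL rhoK f -> f x <> 0 ->
  repr_ker rhoL `<=` repr_ker rhoK.
Proof.
move=> irrK eqf fx0.
have [||U UP] := @vspace_of_linear_closed _ K
    (fun y => forall n, repr_ker rhoL n -> rhoK n y = y).
- by move=> n _; rewrite linear0.
- by move=> a y z Py Pz n kn; rewrite linearP /= Py // Pz.
have [|U0|U1] := irrK.2 U.
- move=> h; apply/subvP => _ /memv_imgP[y yU ->]; apply/UP => n kn.
  have kc : repr_ker rhoL (h^-1 * (n * h))%g.
    by rewrite /repr_ker /= !repr_M kn comp_lfun1l -repr_M mulVg repr_1.
  by rewrite -[in RHS]((UP y).1 yU _ kc) !reprM reprKV.
- case: fx0; apply/eqP; rewrite -memv0 -U0; apply/UP => n kn.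
  by rewrite eqf kn id_lfunE.
- move=> n kn; apply/lfunP => y; rewrite id_lfunE.
  by apply: (UP y).1 => //; rewrite U1 memvf.
Qed.

(** In other words, [rhoK] factors through the image of [rhoL], so preimages in [G] may be chosen
    arbitrarily. *)
Lemma repr_ker_sub_eq (g h : G) : repr_ker rhoL `<=` repr_ker rhoK ->
  rhoL g = rhoL h -> rhoK g = rhoK h.
Proof.
move=> kerLK gh; have : repr_ker rhoK (h^-1 * g)%g.
  by apply: kerLK; rewrite /repr_ker /= repr_M gh -repr_M mulVg repr_1.
by rewrite /repr_ker /= => hg; rewrite -[g in LHS](mulVKg h) repr_M hg comp_lfun1r.
Qed.

Lemma Hom_pl_of_finite_image (s0 : seq 'End(L)) (v : K) :
  (forall g, rhoL g \in s0) -> repr_ker rhoL `<=` repr_ker rhoK -> v <> 0 ->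
  exists f x, Hom_pl rhoL rhoK f /\ f x <> 0.
Proof.
move=> fin kerLK v0.
(* The exact image of [rhoL], without repetitions, so that it can index the averaging sum. *)
pose s := undup [seq h <- s0 | `[< exists g, rhoL g = h >]].
have sP h : h \in s <-> exists g, rhoL g = h.
  rewrite mem_undup mem_filter; split=> [/andP[/asboolP]//|[g <-]].
  by rewrite fin andbT; apply/asboolP; exists g.
have s_uniq : uniq s by exact: undup_uniq.
have s1 : \1%VF \in s by apply/sP; exists 1%g; rewrite repr_1.
have [sec secP] : exists sec : 'End(L) -> G,
    forall h, h \in s -> rhoL (sec h) = h.
  have /boolp.choice[sec secP] : forall h : 'End(L),
      exists g : G, h \in s -> rhoL g = h.
    move=> h; have [/sP[g <-]|nh] := pselect (h \in s); first by exists g.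
    by exists 1%g.
  by exists sec.
(* Each nontrivial [h] fixes only a thin set, so some point has trivial stabilizer in the image. *)
have [x0 x0P] : exists x0, forall h, h \in s -> h x0 = x0 -> h = \1%VF.
  apply: contrapT => nx; apply: (@not_thinT R L).
  apply: (@sub_thin _ _ _ (\bigcup_(h in [set` [seq h <- s | h != \1%VF]])
      [set x | affine (h, 0) x = affine (\1%VF, 0) x])).
    move=> x _; apply: contrapT => xh; apply: nx; exists x => h hs hx.
    apply: contrapT => /eqP h1; apply: xh; exists h.
      by rewrite /= mem_filter h1.
    by rewrite /= /affine /= !addr0 id_lfunE.
  apply: thin_bigcup => h; rewrite mem_filter => /andP[h1 _].
  by apply: thin_affine_eq; rewrite xpair_eqE negb_and h1.
pose orbit := [seq (h : 'End(L)) x0 | h <- s].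
have orbitP g : rhoL g x0 \in orbit.
  by apply/mapP; exists (rhoL g) => //; apply/sP; exists g.
have [|x [chi [c [xorb cx xmax]]]] := @finite_exposed_point R L orbit.
  by rewrite -size_eq0 size_map size_eq0; case: (s) s1.
have [u xE] : exists u, x = rhoL u x0.
  by have /mapP[h /sP[u <-] ->] := xorb; exists u.
have xfree g : rhoL g x = x -> rhoL g = \1%VF.
  move=> gx; have conj_fix : rhoL (u^-1 * (g * u))%g = \1%VF.
    apply: x0P; first by apply/sP; exists (u^-1 * (g * u))%g.
    by rewrite !reprM -xE gx xE reprVK.
  rewrite -[g](mulgK u) -[X in (X / u)%g](mulVKg u) repr_M [rhoL (u * _)%g]repr_M.
  by rewrite conj_fix comp_lfun1r -repr_M mulgV repr_1.
(* The hinge at the exposed orbit point [x], transported by [h] together with its value [v]. At [x]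
   only the term of the identity survives: for other [h] the point [h^-1 x] is a different orbit
   point, where the hinge vanishes. *)
pose T h y : K := Num.max 0 ((chi (rhoL (sec h)^-1%g y) : R) - c) *: rhoK (sec h) v.
exists (fun y => \sum_(h <- s) T h y), x; split; last first.
  rewrite (bigD1_seq \1%VF) //= big_seq_cond big1 ?addr0.
    have sec1 : rhoL (sec \1%VF) = rhoL 1%g by rewrite secP // repr_1.
    rewrite /T (repr_ker_sub_eq kerLK sec1) repr_1 id_lfunE.
    have -> : rhoL (sec \1%VF)^-1%g x = x.
      by rewrite -[RHS](reprVK rhoL (sec \1%VF)) sec1 repr_1 id_lfunE.
    rewrite max_r ?subr_ge0 ?ltW //; move/eqP; rewrite scaler_eq0 subr_eq0.
    by rewrite gt_eqF //= => /eqP.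
  move=> h /andP[hs h1]; rewrite /T max_l ?scale0r // subr_le0.
  apply: xmax; first by rewrite xE -reprM.
  apply: contra h1 => /eqP hx; rewrite -(secP h hs); apply/eqP/xfree.
  by rewrite -{1}hx reprKV.
split; last first.
  apply: piecewise_linear_sum => h.
  have -> : T h = fun y => Num.max 0 (((chi \o rhoL (sec h)^-1%g)%VF y : R) - c) *:
      rhoK (sec h) v.
    by apply/funext => y; rewrite comp_lfunE.
  exact: hinge_piecewise_linear.
move=> g y.
have gs h : h \in s -> (rhoL g \o h)%VF \in s.
  by move=> /sP[k <-]; apply/sP; exists (g * k)%g; rewrite repr_M.
have perm_s : perm_eq s [seq (rhoL g \o h)%VF | h <- s].
  apply: uniq_perm => // [|k].
    rewrite map_inj_in_uniq // => h k _ _ /(congr1 (comp_lfun (rhoL g^-1%g))).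
    by rewrite !comp_lfunA -repr_M mulVg repr_1 !comp_lfun1l.
  apply/idP/mapP => [/sP[h <-]|[h hs ->]]; last exact: gs.
  exists (rhoL (g^-1 * h)%g); first by apply/sP; exists (g^-1 * h)%g.
  by rewrite -repr_M mulVKg.
rewrite linear_sum [RHS](perm_big _ perm_s) /= big_map big_seq [RHS]big_seq.
apply: eq_bigr => h hs.
(* [sec] is multiplicative only modulo the kernel of [rhoL], which is enough since this kernel also
   acts trivially on [K]. *)
have e : rhoL (sec (rhoL g \o h)%VF) = rhoL (g * sec h)%g.
  by rewrite secP ?gs // repr_M secP.
rewrite /T linearZ /= -reprM (repr_ker_sub_eq kerLK e).
congr (Num.max 0 (chi _ - c) *: _).
by rewrite -{2}[y](reprKV rhoL (sec h)) -(reprM rhoL g (sec h)) -e reprVK.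
Qed.

End Equivariance.

(** * Schur's lemma and fixed vectors of irreducible representations *)

Section Schur.
Context {R : realType} {G : topologicalGroupType} {L K : vectType R}.
Variables (rhoL : representation G L) (rhoK : representation G K).
Hypotheses (irrL : irreducible rhoL) (irrK : irreducible rhoK).

Lemma schur (M : 'Hom(L, K)) :
  equivariant rhoL rhoK M -> M <> 0 -> isomorphic rhoL rhoK.
Proof.
move=> eqM M0; have kerM : lker M = 0%VS.
  have [|//|kT] := irrL.2 (lker M).
    move=> g; apply/subvP => _ /memv_imgP[x xM ->].
    by rewrite memv_ker -eqM; move: xM; rewrite memv_ker => /eqP ->; rewrite linear0.
  case: M0; apply/lfunP => x; rewrite zero_lfunE; apply/eqP.
  by rewrite -memv_ker kT memvf.
have imM : limg M = {:K}%VS.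
  have [|im0|//] := irrK.2 (limg M).
    move=> g; apply/subvP => _ /memv_imgP[_ /memv_imgP[x _ ->] ->].
    by rewrite eqM memv_img // memvf.
  case: M0; apply/lfunP => x; rewrite zero_lfunE; apply/eqP.
  by rewrite -memv0 -im0 memv_img // memvf.
exists M; split=> //; exists M^-1%VF.
  by apply: lker0_lfunK; rewrite kerM.
by move=> y; apply: limg_lfunVK; rewrite imM memvf.
Qed.

(** The line spanned by [b] is invariant, hence all of [K], and a functional with value 1 at [b] is
    the isomorphism. *)
Lemma fixed_vector_trivial (b : K) :
  (forall g, rhoK g b = b) -> b <> 0 -> isomorphic rhoK (triv_repr R G).
Proof.
move=> bfix /eqP b0; have lineT : (<[b]> = {:K})%VS.
  have [|line0|//] := irrK.2 <[b]>%VS.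
    by move=> g; rewrite limg_line bfix.
  by move: b0; rewrite -memv0 -line0 memv_line.
have [psi psib] := functional_neq0 b0.
have psiE y : y = (psi y : R) *: b.
  have /vlineP[k ->] : y \in <[b]>%VS by rewrite lineT memvf.
  by rewrite linearZ /= psib /GRing.scale /= mulr1.
exists psi; split.
  exists (fun a : R^o => (a : R) *: b) => [y|a]; first by rewrite -psiE.
  by rewrite linearZ /= psib /GRing.scale /= mulr1.
move=> g y; rewrite id_lfunE; congr (psi _).
by rewrite [in RHS](psiE y) linearZ /= bfix -psiE.
Qed.

End Schur.

Theorem corollary2p7 (R : realType) (G : topologicalGroupType)
    (L K : vectType R) (rhoL : representation G L) (rhoK : representation G K)
    (compactG : compact_group G)
    (irrL : irreducible rhoL) (irrK : irreducible rhoK) :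
  (acts_trivially rhoL (identity_component G) ->
     (Hom_pl rhoL rhoK <> [set 0]
        <-> repr_ker rhoL `<=` repr_ker rhoK)) /\
  (~ acts_trivially rhoL (identity_component G) ->
     (forall f : L -> K, Hom_pl rhoL rhoK f -> affine_linear f) /\
     (Hom_pl rhoL rhoK <> [set 0]
        <-> isomorphic rhoL rhoK \/ isomorphic rhoK (triv_repr R G))).
Proof.
have nonzero (V : vectType R) : {:V}%VS <> 0%VS -> exists v : V, v <> 0.
  move=> V0; exists (vpick {:V}); move=> /eqP; rewrite vpick0 => /eqP.
  exact: V0.
split=> [trivial|nontrivial].
  rewrite Hom_pl_neq0; split=> [[f [x [[eqf _] fx0]]]|kerLK].
    exact: equivariant_repr_ker_sub irrK eqf fx0.
  have [s sP] := repr_finite_image compactG trivial.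
  have [v v0] := nonzero K irrK.1.
  exact: Hom_pl_of_finite_image sP kerLK v0.
have aff f (Hf : Hom_pl rhoL rhoK f) :=
  equivariant_piecewise_linear_affine compactG irrL nontrivial Hf.
split=> [f /aff[a fa]|]; first by exists a.1, a.2.
rewrite Hom_pl_neq0; split=> [[f [x [Hf fx0]]]|[[M [Mbij eqM]]|[h [[k hk kh] eqh]]]].
- have [[M b] fE] := aff f Hf; rewrite /affine /= in fE.
  (* Equivariance at 0 makes the translation part fixed. It then cancels, so [M] is equivariant;
     either [M] is nonzero and Schur applies, or [b] is a nonzero fixed vector. *)
  have bfix g : rhoK g b = b.
    have := Hf.1 g 0; rewrite !fE linear0 (linear0 (rhoL g)).
    by rewrite (linear0 M) add0r.
  have [M0|M0] := pselect (M = 0); last first.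
    left; apply: (schur irrL irrK) M0 => g y.
    have := Hf.1 g y; rewrite !fE linearD /= bfix; exact: addIr.
  right; apply: (fixed_vector_trivial irrK bfix) => b0; apply: fx0.
  by rewrite fE M0 b0 zero_lfunE addr0.
- have [x x0] := nonzero L irrL.1.
  exists M, x; split; last first.
    by move=> Mx; apply: x0; apply: (bij_inj Mbij); rewrite Mx linear0.
  split=> //; have -> : (M : L -> K) = (fun y => M y + 0).
    by apply/funext => y; rewrite addr0.
  exact: affine_piecewise_linear.
(* The preimage of 1 in [K] is a nonzero fixed vector, so the constant map with this value is
   equivariant. *)
- exists (fun=> k 1), 0; split; last first.
    move=> k1; have := kh 1; rewrite k1 linear0 => /eqP.
    by rewrite eq_sym oner_eq0.
  split=> [g y|].
    by apply: (can_inj hk); rewrite -eqh id_lfunE.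
  have -> : (fun=> k 1) = (fun y => (0 : 'Hom(L, K)) y + k 1).
    by apply/funext => y; rewrite zero_lfunE add0r.
  exact: affine_piecewise_linear.
Qed.
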